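(* Let $c>1$ and let $G_c$ be the connected and simply connected Lie group whose Lie algebra $\mathfrak{g}_c$ has a basis $\{x,y,z\}$ with $[x,y]=0$, $[z,x]=y$, $[z,y]=-cx+2y$. Let $h$ be a left invariant Lorentzian metric on $G_c$ with matrix $[h]$ with respect to $\{x,y,z\}$. In each case below $\{y_1,y_2,y_3\}$ is an $h$-orthonormal basis of $\mathfrak{g}_c$, and the Ricci operator $\mathrm{Ric}$ of $h$ has the stated matrix with respect to it and the stated O'Neill type. (1) If $[h]=\begin{bmatrix}\mu&0&0\\0&0&1\\0&1&0\end{bmatrix}$ with $\mu>0$, and $y_1=\frac{1}{\sqrt\mu}x$, $y_2=\frac{1}{\sqrt2}(y+z)$, $y_3=\frac1{\sqrt2}(y-z)$, then $$[\mathrm{Ric}]_{\{y_i\}}=\begin{bmatrix}-\frac{c^2\mu}{2}&0&0\\0&\frac{c(c\mu+1)}{2}&-\frac c2\\0&\frac c2&\frac{c(c\mu-1)}{2}\end{bmatrix}\quad(\text{O'Neill type }\{21\}).$$ (2) If $[h]=\begin{bmatrix}1&1&0\\1&\tau&0\\0&0&\mu\end{bmatrix}$ with $\mu>0$, $\tau<1$, and $y_1=\frac1{\sqrt\mu}z$, $y_2=x$, $y_3=\frac{1}{\sqrt{1-\tau}}(x-y)$, then $$[\mathrm{Ric}]_{\{y_i\}}=\begin{bmatrix}\frac{\tau^2+(4-2c)\tau+(c^2-4)}{2(1-\tau)\mu}&0&0\\0&\frac{\tau^2+2\tau-(c^2-2c+4)}{2(1-\tau)\mu}&-\frac{c-\tau}{\mu\sqrt{1-\tau}}\\0&\frac{c-\tau}{\mu\sqrt{1-\tau}}&-\frac{\tau^2-6\tau-(c^2-2c-4)}{2(1-\tau)\mu}\end{bmatrix},$$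 and $\mathrm{Ric}$ is of O'Neill type $\{11,1\}$, $\{1z\bar z\}$, $\{21\}$ when $(c+\tau)^2-4c>0$, $<0$, $=0$, respectively. (3) If $[h]=\begin{bmatrix}1&1&0\\1&\nu&0\\0&0&-\mu\end{bmatrix}$ with $\mu>0$, $1<\nu\le c$, and $y_1=x$, $y_2=\frac{1}{\sqrt{\nu-1}}(x-y)$, $y_3=\frac1{\sqrt\mu}z$, then $$[\mathrm{Ric}]_{\{y_i\}}=\begin{bmatrix}\frac{\nu^2+2\nu-(c^2-2c+4)}{2(\nu-1)\mu}&\frac{c-\nu}{\mu\sqrt{\nu-1}}&0\\\frac{c-\nu}{\mu\sqrt{\nu-1}}&-\frac{\nu^2-6\nu-(c^2-2c-4)}{2(\nu-1)\mu}&0\\0&0&\frac{(\nu-c)^2+4(\nu-1)}{2(\nu-1)\mu}\end{bmatrix}\quad(\text{O'Neill type }\{11,1\}).$$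
   Context: A left invariant Lorentzian metric $h$ on a connected three-dimensional Lie group $G$ is identified with a nondegenerate symmetric bilinear form of signature $(+,+,-)$ on its Lie algebra $\mathfrak{g}$; its matrix $[h]$ in a basis of $\mathfrak{g}$ satisfies $h(u,v)=[u]^t[h][v]$. A basis $\{y_1,y_2,y_3\}$ is $h$-orthonormal if $h(y_1,y_1)=h(y_2,y_2)=1$, $h(y_3,y_3)=-1$ and $h(y_i,y_j)=0$ for $i\ne j$. The Levi-Civita connection $\nabla:\mathfrak{g}\times\mathfrak{g}\to\mathfrak{g}$ is given by $2h(\nabla_uv,w)=h([u,v],w)+h([w,u],v)+h([w,v],u)$. The curvature is $R_{uv}=\nabla_{[u,v]}-(\nabla_u\nabla_v-\nabla_v\nabla_u)$, the Ricci curvature $\mathrm{ric}(u,v)$ is the trace of $w\mapsto R_{uw}v$, and the Ricci operator $\mathrm{Ric}:\mathfrak{g}\to\mathfrak{g}$ is defined by $h(\mathrm{Ric}(u),v)=\mathrm{ric}(u,v)$. The $j$-th column of $[\mathrm{Ric}]_{\{y_i\}}$ is the coordinate vector of $\mathrm{Ric}(y_j)$. O'Neill types of an $h$-self-adjoint operator $T$ (matrix columns are images of basis vectors): type $\{11,1\}$ if $T$ has a diagonal matrix in some $h$-orthonormal basis; type $\{1z\bar z\}$ if in some $h$-orthonormal basis its matrix is $\begin{bmatrix}a&0&0\\0&\alpha&\beta\\0&-\beta&\alpha\end{bmatrix}$ with $\beta\ne0$; type $\{21\}$ if in some basis $\{e,u,v\}$ whose only non-zero products are $h(e,e)=h(u,v)=1$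 its matrix is $\begin{bmatrix}a&0&0\\0&b&\epsilon\\0&0&b\end{bmatrix}$ with $\epsilon=\pm1$. *)

(* Defs.v *)
From HB Require Import structures.
From mathcomp Require Import all_boot all_order all_algebra.
From mathcomp Require Import reals ring.

Set Implicit Arguments.
Unset Strict Implicit.
Unset Printing Implicit Defensive.

Import Order.TTheory GRing.Theory Num.Theory.
Local Open Scope ring_scope.

Record lieAlgebra (R : realType) := LieAlgebra {
  lie_vect :> vectType R;
  lie_br : {bilinear lie_vect -> lie_vect -> lie_vect};
  lie_brxx : forall u, lie_br u u = 0;
  lie_jacobi : forall u v w,
    lie_br u (lie_br v w) + lie_br v (lie_br w u) + lie_br w (lie_br u v) = 0
}.
Arguments lie_br {R l}.

Lemma linfunE (R : fieldType) (U V : vectType R) (f : U -> V) :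
  linear f -> linfun f =1 f.
Proof.
move=> flin.
pose l := GRing.isLinear.Build R U V _ f flin.
pose L : {linear U -> V} := HB.pack f l.
exact: (lfunE L).
Qed.

Section LinearAlgebra.
Variables (R : realType) (V : vectType R).

Definition mx_of_rows n (s : seq (seq R)) : 'M[R]_n :=
  \matrix_(i < n, j < n) (nth [::] s i)`_j.

(* Column convention: column j holds the coordinates of T e_j
   (the library's [mxof] is the transpose). *)
Definition matrix_of n (e : n.-tuple V) (T : 'End(V)) : 'M[R]_n :=
  \matrix_(i, j) coord e i (T e`_j).

Definition gram n (h : {symmetric V}) (e : n.-tuple V) : 'M[R]_n :=
  \matrix_(i, j) h e`_i e`_j.

Definition lftrace (T : 'End(V)) : R := \tr (matrix_of (vbasis {:V}) T).

Lemma lftraceE n (e : n.-tuple V) (T : 'End(V)) :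
  basis_of {:V} e -> lftrace T = \tr (matrix_of e T).
Proof.
move=> be; have bf := vbasisP {:V}; rewrite /lftrace.
set f := vbasis _ in bf *.
pose P := \matrix_(i < \dim {:V}, j < n) coord f i e`_j.
pose Q := \matrix_(i < n, j < \dim {:V}) coord e i f`_j.
have -> : matrix_of f T = P *m matrix_of e T *m Q.
  apply/matrixP => i j; rewrite !mxE.
  rewrite [f`_j](coord_basis be (memvf _)) linear_sum linear_sum /=.
  apply: eq_bigr => k _; rewrite linearZ linearZ /= !mxE mulrC; congr (_ * _).
  rewrite [T _ in LHS](coord_basis be (memvf _)) linear_sum.
  by apply: eq_bigr => l _; rewrite linearZ /= !mxE mulrC.
rewrite mxtrace_mulC mulmxA; suff -> : Q *m P = 1%:M by rewrite mul1mx.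
apply/matrixP => i j; rewrite !mxE.
rewrite eq_sym -(coord_free j i (basis_free be)).
rewrite [in RHS](coord_basis bf (memvf e`_j)) linear_sum.
by apply: eq_bigr => l _; rewrite linearZ /= !mxE mulrC.
Qed.

Section Form.
Variable h : {symmetric V}.

Definition orthonormal_basis (e : 3.-tuple V) : Prop :=
  basis_of {:V} e /\
  gram h e = mx_of_rows 3 [:: [:: 1; 0; 0];
                              [:: 0; 1; 0];
                              [:: 0; 0; -1]].

Definition lorentzian : Prop :=
  nondegenerate h /\ exists e, orthonormal_basis e.

(* Each of the O'Neill normal forms below forces T to be h-self-adjoint. *)

Definition type_11_1 (T : 'End(V)) : Prop :=
  exists e : 3.-tuple V, orthonormal_basis e /\ is_diag_mx (matrix_of e T).

Definition type_1zz (T : 'End(V)) : Prop :=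
  exists (e : 3.-tuple V) (a alpha beta : R),
    [/\ orthonormal_basis e, beta != 0
      & matrix_of e T = mx_of_rows 3 [:: [:: a; 0; 0];
                                         [:: 0; alpha; beta];
                                         [:: 0; - beta; alpha]]].

Definition type_21 (T : 'End(V)) : Prop :=
  exists (e : 3.-tuple V) (a b eps : R),
    [/\ basis_of {:V} e,
        gram h e = mx_of_rows 3 [:: [:: 1; 0; 0];
                                    [:: 0; 0; 1];
                                    [:: 0; 1; 0]],
        eps = 1 \/ eps = -1
      & matrix_of e T = mx_of_rows 3 [:: [:: a; 0; 0];
                                         [:: 0; b; eps];
                                         [:: 0; 0; b]]].

(* The musical isomorphisms of h; [sharp] is the inverse of [flat] as soon as
   h is nondegenerate, see [sharpP]. *)
Definition flat : 'Hom(V, 'Hom(V, R^o)) :=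
  linfun (fun u => linfun (fun v => h u v : R^o)).

Definition sharp : 'Hom('Hom(V, R^o), V) := (flat^-1)%VF.

Lemma flatE u v : flat u v = h u v.
Proof.
have E w : linfun (fun v => h w v : R^o) =1 h w.
  by apply: linfunE => a p q; rewrite linearPr.
rewrite /flat linfunE ?E // => a p q.
by apply/lfunP => w; rewrite !lfunE /= !lfunE /= !E linearPl.
Qed.

Lemma sharpP (phi : 'Hom(V, R^o)) v :
  nondegenerate h -> h (sharp phi) v = phi v.
Proof.
move=> /eqP h0; rewrite -flatE.
suff -> : flat (sharp phi) = phi by [].
have ker0 : lker flat == 0%VS.
  rewrite -subv0 -h0; apply/subvP => u; rewrite memv_ker => /eqP fu0.
  by apply/mem_orthovP => w _; rewrite -flatE fu0 lfunE.
apply: limg_lfunVK; suff -> : limg flat = fullv by rewrite memvf.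
apply/eqP; rewrite eqEdim subvf limg_dim_eq ?(eqP ker0) ?capv0 //.
by rewrite !dimvf /dim /= muln1.
Qed.
End Form.
End LinearAlgebra.

Section Curvature.
Variables (R : realType) (g : lieAlgebra R) (h : {symmetric g}).

(* [levi_civita u] is the endomorphism nabla_u; the Koszul formula that
   determines it is [koszul] below. *)
Definition levi_civita (u : g) : 'End(g) :=
  linfun (fun v => sharp h (linfun (fun w =>
    2^-1 * (h (lie_br u v) w + h (lie_br w u) v + h (lie_br w v) u) : R^o))).

Definition curvature (u v : g) : 'End(g) :=
  levi_civita (lie_br u v)
  - ((levi_civita u \o levi_civita v)%VF - (levi_civita v \o levi_civita u)%VF).

Definition ricci (u v : g) : R := lftrace (linfun (fun w => curvature u w v)).

Definition ricci_op : 'End(g) :=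
  linfun (fun u => sharp h (linfun (fun v => ricci u v : R^o))).

Hypothesis nd : nondegenerate h.

Lemma sharp_linfun (phi : g -> R^o) v :
  linear phi -> h (sharp h (linfun phi)) v = phi v.
Proof. by move=> philin; rewrite sharpP ?linfunE. Qed.

Lemma nondegenerate_inj u v : (forall w, h u w = h v w) -> u = v.
Proof.
move=> e; apply/eqP; rewrite -subr_eq0 -memv0 -(eqP nd).
by apply/mem_orthovP => w _; rewrite linearBl /= e subrr.
Qed.

Lemma koszul u v w :
  2 * h (levi_civita u v) w
  = h (lie_br u v) w + h (lie_br w u) v + h (lie_br w v) u.
Proof.
have lin1 v' : linear (fun w =>
    2^-1 * (h (lie_br u v') w + h (lie_br w u) v' + h (lie_br w v') u) : R^o).
  move=> a p q.
  rewrite linearPr [lie_br (_ + _) u]linearPl [lie_br (_ + _) v']linearPl.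
  rewrite !linearPl /= /GRing.scale /=; ring.
rewrite linfunE; last first.
  move=> a p q; apply: nondegenerate_inj => w'.
  rewrite linearPl /= !sharp_linfun //= [lie_br u (_ + _)]linearPr [lie_br w' (_ + _)]linearPr.
  by rewrite !linearPl !linearPr /= /GRing.scale /=; ring.
by rewrite sharp_linfun // mulrA mulfV ?mul1r // pnatr_eq0.
Qed.

Lemma levi_civita_linear : linear levi_civita.
Proof.
move=> a p q; apply/lfunP => v; apply: nondegenerate_inj => w.
apply: (mulfI (_ : 2 != 0 :> R)); first by rewrite pnatr_eq0.
rewrite koszul add_lfunE scale_lfunE [h (_ + _) w]linearPl /=.
rewrite mulrDr (mulrCA 2) !koszul.
rewrite [lie_br (_ + _) v]linearPl [lie_br w (_ + _)]linearPr.
by rewrite linearPr !linearPl /= /GRing.scale /=; ring.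
Qed.

Lemma curvatureE u v w :
  curvature u v w = levi_civita (lie_br u v) w
  - (levi_civita u (levi_civita v w) - levi_civita v (levi_civita u w)).
Proof.
by rewrite /curvature !(add_lfunE, opp_lfunE) !comp_lfunE.
Qed.

Let subrPP (a : R) (p q p' q' : g) :
  (a *: p + q) - (a *: p' + q') = a *: (p - p') + (q - q').
Proof. by rewrite opprD addrACA scalerBr. Qed.

Lemma curvature_linear_l v w : linear (fun u => curvature u v w).
Proof.
move=> a p q; rewrite !curvatureE linearPl /= !levi_civita_linear.
by rewrite !add_lfunE !scale_lfunE linearP /= !subrPP.
Qed.

Lemma curvature_linear_r u w : linear (fun v => curvature u v w).
Proof.
move=> a p q; rewrite !curvatureE linearPr /= !levi_civita_linear.
by rewrite !add_lfunE !scale_lfunE linearP /= !subrPP.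
Qed.

Lemma ricciE n (e : n.-tuple g) u v : basis_of {:g} e ->
  ricci u v = \sum_i coord e i (curvature u e`_i v).
Proof.
move=> be; rewrite /ricci (lftraceE _ be); apply: eq_bigr => i _.
by rewrite mxE linfunE //; apply: curvature_linear_r.
Qed.

Lemma ricci_opP u v : h (ricci_op u) v = ricci u v.
Proof.
have be := vbasisP {:g}.
have lin v' : linear (fun v => ricci v' v : R^o).
  move=> a p q; rewrite !(ricciE _ _ be) scaler_sumr -big_split /=.
  by apply: eq_bigr => i _; rewrite !linearP.
rewrite linfunE ?sharp_linfun // => a p q.
apply: nondegenerate_inj => w; rewrite linearPl /= !sharp_linfun //.
rewrite !(ricciE _ _ be) mulr_sumr -big_split /=.
by apply: eq_bigr => i _; rewrite curvature_linear_l linearP.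
Qed.
End Curvature.

(* Main.v *)
(* In the basis (x, y, z) the Koszul formula, the curvature and the Ricci
   operator are rational functions of c and of the entries of [h]; cases (2) and
   (3) are the same computation, with z spacelike or timelike. A change of basis
   by an explicit matrix then gives the Ricci matrix in (y1, y2, y3).

   The O'Neill type of an operator with an invariant spacelike line and the block
   [[A, -q], [q, D]] on its Lorentzian complement is read off the discriminant
   (A - D)^2 - 4 q^2: when it is positive a boost cancels the off-diagonal entry,
   when it is negative a boost equates the diagonal entries, and when it is zero
   with q <> 0 a null basis adapted to the null eigenline gives type {21}. In
   case (2) this discriminant is (c + tau)^2 - 4 c up to a positive factor. In
   case (3) the block lies on a definite plane, where a rotation diagonalises. *)

Require Import Defs.
From mathcomp Require Import all_boot all_order all_algebra.
From mathcomp Require Import reals ring lra.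
Set Implicit Arguments.
Unset Strict Implicit.
Unset Printing Implicit Defensive.
Import Order.TTheory GRing.Theory Num.Theory.
Local Open Scope ring_scope.

Ltac mx3_entries :=
  congr (mx_of_rows 3 [:: [:: _; _; _]; [:: _; _; _]; [:: _; _; _]]).

(** * Gram matrices and operator matrices under a change of basis *)

Section ChangeOfBasis.
Variables (R : realType) (V : vectType R).

Lemma mul_mx_of_rows3 (a b c d e f g h i a' b' c' d' e' f' g' h' i' : R) :
  mx_of_rows 3 [:: [:: a; b; c]; [:: d; e; f]; [:: g; h; i]]
  *m mx_of_rows 3 [:: [:: a'; b'; c']; [:: d'; e'; f']; [:: g'; h'; i']]
  = mx_of_rows 3
      [:: [:: a * a' + b * d' + c * g'; a * b' + b * e' + c * h';
              a * c' + b * f' + c * i'];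
          [:: d * a' + e * d' + f * g'; d * b' + e * e' + f * h';
              d * c' + e * f' + f * i'];
          [:: g * a' + h * d' + i * g'; g * b' + h * e' + i * h';
              g * c' + h * f' + i * i']].
Proof.
apply/matrixP; case=> [[|[|[|//]]] ?] [[|[|[|//]]] ?];
by rewrite !mxE !big_ord_recl big_ord0 !mxE /= addr0 addrA.
Qed.

Lemma tr_mx_of_rows3 (a b c d e f g h i : R) :
  (mx_of_rows 3 [:: [:: a; b; c]; [:: d; e; f]; [:: g; h; i]])^T
  = mx_of_rows 3 [:: [:: a; d; g]; [:: b; e; h]; [:: c; f; i]].
Proof.
by apply/matrixP; case=> [[|[|[|//]]] ?] [[|[|[|//]]] ?]; rewrite !mxE.
Qed.

Lemma mx_of_rows3_1 :
  1%:M = mx_of_rows 3 [:: [:: 1; 0; 0]; [:: 0; 1; 0]; [:: 0; 0; 1]] :> 'M[R]_3.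
Proof.
by apply/matrixP; case=> [[|[|[|//]]] ?] [[|[|[|//]]] ?]; rewrite !mxE.
Qed.

(** Column [j] of [P] holds the coordinates of the new vector [j], in agreement with the column
    convention of [matrix_of]. *)
Definition comb n (e : n.-tuple V) (P : 'M[R]_n) : n.-tuple V :=
  [tuple \sum_i P i j *: e`_i | j < n].

Lemma nth_comb n (e : n.-tuple V) P (j : 'I_n) :
  (comb e P)`_j = \sum_i P i j *: e`_i.
Proof. by rewrite -tnth_nth tnth_mktuple. Qed.

Lemma comb3E (x y z : V) (a b c d e f g h i : R) :
  comb [tuple x; y; z]
    (mx_of_rows 3 [:: [:: a; b; c]; [:: d; e; f]; [:: g; h; i]])
  = [tuple a *: x + d *: y + g *: z; b *: x + e *: y + h *: z;
           c *: x + f *: y + i *: z].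
Proof.
apply: eq_from_tnth; case=> [[|[|[|//]]] lt3];
by rewrite tnth_mktuple !big_ord_recl big_ord0 !mxE /= addr0 addrA.
Qed.

Lemma gram_comb n (h : {symmetric V}) (e : n.-tuple V) P :
  gram h (comb e P) = P^T *m gram h e *m P.
Proof.
apply/matrixP => i j; rewrite mxE !nth_comb linear_sumr !mxE.
apply: eq_bigr => k _; rewrite linearZr_LR linear_sumlz /= mulrC mxE.
by congr (_ * _); apply: eq_bigr => l _; rewrite linearZl_LR /= !mxE.
Qed.

Lemma matrix_of_basis n (e : n.-tuple V) (T : 'End(V)) (M : 'M[R]_n) :
  basis_of {:V} e -> (forall j : 'I_n, T e`_j = \sum_i M i j *: e`_i) ->
  matrix_of e T = M.
Proof.
move=> be eT; apply/matrixP => i j.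
by rewrite mxE eT coord_sum_free // (basis_free be).
Qed.

(** Stating the hypothesis as an intertwining relation avoids computing the inverse of [P]. *)
Lemma matrix_of_comb n (e : n.-tuple V) P (T : 'End(V)) (M : 'M[R]_n) :
  basis_of {:V} e -> basis_of {:V} (comb e P) ->
  matrix_of e T *m P = P *m M -> matrix_of (comb e P) T = M.
Proof.
move=> be bY eTP; apply: matrix_of_basis => // j.
have -> : T (comb e P)`_j = \sum_k (matrix_of e T *m P) k j *: e`_k.
  rewrite nth_comb linear_sum.
  under eq_bigr => i _.
    rewrite linearZ /= [T _](coord_basis be (memvf _)) scaler_sumr.
    over.
  rewrite exchange_big; apply: eq_bigr => k _; rewrite mxE scaler_suml.
  by apply: eq_bigr => i _; rewrite scalerA mxE mulrC.
rewrite eTP; under [RHS]eq_bigr => l _ do rewrite nth_comb scaler_sumr.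
rewrite exchange_big; apply: eq_bigr => k _; rewrite mxE scaler_suml.
by apply: eq_bigr => l _; rewrite scalerA mulrC.
Qed.

(** Pairing a vanishing combination with every basis vector puts its coefficient row in the left
    kernel of the Gram matrix. *)
Lemma basis_of_gram_unitmx n (h : {symmetric V}) (e : n.-tuple V) :
  \dim {:V} = n -> gram h e \in unitmx -> basis_of {:V} e.
Proof.
move=> dimV unitG; rewrite basisEfree subvf dimV size_tuple leqnn !andbT.
apply/freeP => k ek0 i.
suff /rowP/(_ i) : \row_j k j = 0 by rewrite !mxE.
rewrite -[\row_j _](mulmxK unitG) (_ : _ *m gram h e = 0) ?mul0mx //.
apply/rowP => j; rewrite !mxE.
transitivity (h (\sum_(l < n) k l *: e`_l) e`_j); last by rewrite ek0 linear0l.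
by rewrite linear_sumlz; apply: eq_bigr => l _; rewrite linearZl_LR !mxE.
Qed.

(* The Gram matrices at stake are symmetric involutions, which makes their
   invertibility immediate. *)
Lemma change_of_basis n (h : {symmetric V}) (e : n.-tuple V) P G
    (T : 'End(V)) (M : 'M[R]_n) :
  basis_of {:V} e -> P^T *m gram h e *m P = G -> G *m G = 1%:M ->
  matrix_of e T *m P = P *m M ->
  [/\ basis_of {:V} (comb e P), gram h (comb e P) = G
    & matrix_of (comb e P) T = M].
Proof.
move=> be eG GG eM.
have gY : gram h (comb e P) = G by rewrite gram_comb.
have bY : basis_of {:V} (comb e P).
  apply: (basis_of_gram_unitmx (h := h)); last by rewrite gY; have [] := mulmx1_unit GG.
  by rewrite (size_basis be).
by split=> //; apply: matrix_of_comb.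
Qed.
End ChangeOfBasis.

(** * Boosts, rotations and the O'Neill normal forms *)

Section NormalForms.
Variable R : realType.

(** Giving the root the sign of [d] prevents cancellation in [d + s], so that the normalising
    factors built from [(d + s) * s] are positive. *)
Let signed_sqrt (a d : R) : 0 <= a ->
  exists s, s ^+ 2 = a /\ (0 < a -> 0 < (d + s) * s).
Proof.
move=> a0; have sa := sqr_sqrtr a0; have s0 := sqrtr_ge0 a.
have [d0|d0] := leP 0 d.
  exists (Num.sqrt a); split=> //.
  rewrite -sqrtr_gt0 => s1; apply: mulr_gt0 => //; exact: ltr_wpDl.
exists (- Num.sqrt a); split; first by rewrite sqrrN.
rewrite -sqrtr_gt0 => s1; rewrite nmulr_rgt0 ?oppr_lt0 //.
by rewrite -oppr_gt0 opprD opprK addr_gt0 // oppr_gt0.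
Qed.

Let mul_normalized (d a b N n : R) : N ^+ 2 = n -> n != 0 ->
  d * (a / N) * (b / N) = d * a * b / n.
Proof. by move=> <-; rewrite expf_eq0 => /= N0; field. Qed.

(* With [s ^+ 2 = d ^+ 2 - 4 * q ^+ 2] of the sign of [d], the direction
   [(d + s, 2 * q)] solves the homogeneous equation. *)
Lemma hyperbolic_rotation (d q : R) : 4 * q ^+ 2 < d ^+ 2 ->
  exists p r : R, p ^+ 2 - r ^+ 2 = 1 /\ d * p * r = q * (p ^+ 2 + r ^+ 2).
Proof.
move=> dq; have a0 : 0 < d ^+ 2 - 4 * q ^+ 2 by rewrite subr_gt0.
have [s [s2 /(_ a0) sd]] := signed_sqrt d (ltW a0).
(* Since [4 q^2 = d^2 - s^2], this is the Lorentzian square [(d + s)^2 - (2 q)^2] of the chosen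
   direction. *)
have n0 : 0 < 2 * ((d + s) * s) by rewrite mulr_gt0.
have N2 := sqr_sqrtr (ltW n0); have nz := lt0r_neq0 n0.
set N := Num.sqrt _ in N2.
have q2 : q ^+ 2 = (d ^+ 2 - s ^+ 2) / 4 by rewrite s2; field.
have /andP[ds0 s0] : (d + s != 0) && (s != 0).
  by rewrite -negb_or -mulf_eq0 lt0r_neq0.
exists ((d + s) / N), (2 * q / N); split.
  by rewrite !expr_div_n N2 exprMn q2; field; rewrite ds0 s0.
rewrite (mul_normalized _ _ _ N2 nz) !expr_div_n N2 exprMn q2.
by field; rewrite ds0 s0.
Qed.

(** The double angle has tangent [2 q / d]. The direction is again [(d + s, 2 q)], now with
    [s^2 = d^2 + 4 q^2]; if this vanishes, then [d = q = 0] and the identity rotation serves. *)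
Lemma rotation (d q : R) :
  exists p r : R, p ^+ 2 + r ^+ 2 = 1 /\ d * p * r = q * (p ^+ 2 - r ^+ 2).
Proof.
have a0 : 0 <= d ^+ 2 + 4 * q ^+ 2.
  by rewrite addr_ge0 ?sqr_ge0 // mulr_ge0 ?sqr_ge0.
have [aE|] := eqVneq (d ^+ 2 + 4 * q ^+ 2) 0.
  have [d0 q0] : d = 0 /\ q = 0 by split; nra.
  by exists 1, 0; rewrite d0 q0; split; ring.
move=> anz; have ap : 0 < d ^+ 2 + 4 * q ^+ 2 by rewrite lt_neqAle eq_sym anz.
have [s [s2 /(_ ap) sd]] := signed_sqrt d a0.
have n0 : 0 < 2 * ((d + s) * s) by rewrite mulr_gt0.
have N2 := sqr_sqrtr (ltW n0); have nz := lt0r_neq0 n0.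
set N := Num.sqrt _ in N2.
have q2 : q ^+ 2 = (s ^+ 2 - d ^+ 2) / 4 by rewrite s2; field.
have /andP[ds0 s0] : (d + s != 0) && (s != 0).
  by rewrite -negb_or -mulf_eq0 lt0r_neq0.
exists ((d + s) / N), (2 * q / N); split.
  by rewrite !expr_div_n N2 exprMn q2; field; rewrite ds0 s0.
rewrite (mul_normalized _ _ _ N2 nz) !expr_div_n N2 exprMn q2.
by field; rewrite ds0 s0.
Qed.

Variables (V : vectType R) (h : {symmetric V}) (T : 'End(V)).

Let invol_lorentz : let J := mx_of_rows 3 [:: [:: 1; 0; 0];
                              [:: 0; 1; 0];
                              [:: 0; 0; -1]] : 'M[R]_3 in J *m J = 1%:M.
Proof.
by rewrite /= mul_mx_of_rows3 mx_of_rows3_1; mx3_entries; ring.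
Qed.

Let invol_null : let N := mx_of_rows 3 [:: [:: 1; 0; 0];
                              [:: 0; 0; 1];
                              [:: 0; 1; 0]] : 'M[R]_3 in N *m N = 1%:M.
Proof.
by rewrite /= mul_mx_of_rows3 mx_of_rows3_1; mx3_entries; ring.
Qed.

Lemma change_orthonormal (e : 3.-tuple V) P (M : 'M[R]_3) :
  basis_of {:V} e ->
  P^T *m gram h e *m P = mx_of_rows 3 [:: [:: 1; 0; 0];
                                          [:: 0; 1; 0];
                                          [:: 0; 0; -1]] ->
  matrix_of e T *m P = P *m M ->
  orthonormal_basis h (comb e P) /\ matrix_of (comb e P) T = M.
Proof.
move=> be eG eM.
by have [] := change_of_basis be eG invol_lorentz eM.
Qed.

(** Leaving the boost parameters [p], [r] free lets the same formulas serve both to cancel [b] and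
    to equate the diagonal entries. *)
Lemma boost (e : 3.-tuple V) (a A D q p r : R) :
  orthonormal_basis h e ->
  matrix_of e T = mx_of_rows 3 [:: [:: a; 0; 0];
                                   [:: 0; A; - q];
                                   [:: 0; q; D]] ->
  p ^+ 2 - r ^+ 2 = 1 ->
  let b := (A - D) * p * r - q * (p ^+ 2 + r ^+ 2) in
  exists e' : 3.-tuple V, orthonormal_basis h e' /\
  matrix_of e' T =
    mx_of_rows 3
      [:: [:: a; 0; 0];
          [:: 0; A * p ^+ 2 - 2 * q * p * r - D * r ^+ 2; b];
          [:: 0; - b; D * p ^+ 2 + 2 * q * p * r - A * r ^+ 2]].
Proof.
move=> [be eG] eM pr b.
exists (comb e (mx_of_rows 3 [:: [:: 1; 0; 0]; [:: 0; p; r]; [:: 0; r; p]])).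
apply: change_orthonormal => //.
  rewrite eG tr_mx_of_rows3 !mul_mx_of_rows3.
  by mx3_entries; first [ring | rewrite -[in RHS]pr; ring].
(* In the block, the left side is linear in [p], [r] and the right side cubic; multiplying the left
   by [p^2 - r^2 = 1] leaves a polynomial identity. *)
rewrite eM !mul_mx_of_rows3 /b; mx3_entries;
  first [ring | rewrite -[LHS]mulr1 -[X in _ * X = _]pr; ring].
Qed.

Section Discriminant.
Variables (e : 3.-tuple V) (a A D q : R).
Hypotheses (eO : orthonormal_basis h e)
  (eT : matrix_of e T = mx_of_rows 3 [:: [:: a; 0; 0];
                                         [:: 0; A; - q];
                                         [:: 0; q; D]]).

Lemma type_11_1_of_disc : 0 < (A - D) ^+ 2 - 4 * q ^+ 2 -> type_11_1 h T.
Proof.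
rewrite subr_gt0 => /hyperbolic_rotation[p [r [pr dpr]]].
have [e' [e'O e'T]] := boost eO eT pr.
exists e'; split=> //; rewrite e'T dpr subrr oppr0.
by apply/is_diag_mxP; case=> [[|[|[|//]]] ?] [[|[|[|//]]] ?] //; rewrite mxE.
Qed.

(* The boost that equates the two diagonal entries solves the equation of
   [hyperbolic_rotation] with [(A - D, q)] replaced by [(4 * q, A - D)]. *)
Lemma type_1zz_of_disc : (A - D) ^+ 2 - 4 * q ^+ 2 < 0 -> type_1zz h T.
Proof.
move=> disc.
have /hyperbolic_rotation[p [r [pr qpr]]] : 4 * (A - D) ^+ 2 < (4 * q) ^+ 2.
  by nra.
have [e' [e'O e'T]] := boost eO eT pr.
have diagE : D * p ^+ 2 + 2 * q * p * r - A * r ^+ 2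
    = A * p ^+ 2 - 2 * q * p * r - D * r ^+ 2.
  apply: subr0_eq.
  transitivity (4 * q * p * r - (A - D) * (p ^+ 2 + r ^+ 2)); first by ring.
  by rewrite qpr subrr.
rewrite diagE in e'T.
eexists e', a, _, _; split=> //; last exact: e'T.
(* If [b] vanished too, the equations for [b] and for the equal diagonal entries, both linear in
   [p r] and [p^2 + r^2], would force the discriminant to be zero. *)
apply/negP => /eqP b0.
have p2r2 : 0 < p ^+ 2 + r ^+ 2 by nra.
suff /eqP : ((A - D) ^+ 2 - 4 * q ^+ 2) * (p ^+ 2 + r ^+ 2) = 0.
  by rewrite mulf_eq0 (gt_eqF p2r2) (lt_eqF disc).
transitivity ((A - D) * ((A - D) * (p ^+ 2 + r ^+ 2) - 4 * q * p * r)
  + 4 * q * ((A - D) * p * r - q * (p ^+ 2 + r ^+ 2))); first by ring.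
by rewrite b0 qpr subrr !mulr0 addr0.
Qed.

(* [(0, sigma, 1)] spans the null eigenline, and scaling it by [sqrt |q|]
   normalises the off-diagonal entry to a sign. *)
Lemma type_21_of_disc :
  q != 0 -> (A - D) ^+ 2 - 4 * q ^+ 2 = 0 -> type_21 h T.
Proof.
move=> q0 disc.
(* A zero discriminant means that [A - D] is [2 q] up to sign; [sigma] is this sign, and the double
   eigenvalue is [D + sigma * q]. *)
have [sigma [s2 AE]] : exists sigma : R,
    sigma ^+ 2 = 1 /\ A = D + 2 * sigma * q.
  exists ((A - D) / (2 * q)); split; last by field.
  have -> : ((A - D) / (2 * q)) ^+ 2 =
    ((A - D) ^+ 2 - 4 * q ^+ 2) / (4 * q ^+ 2) + 1 by field.
  by rewrite disc mul0r add0r.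
have sE : sigma = 1 \/ sigma = -1.
  by have /eqP := s2; rewrite sqrf_eq1 => /orP[] /eqP; [left | right].
have [k [eps [k0 epsE qE]]] : exists k eps : R,
    [/\ k != 0, eps = 1 \/ eps = -1 & q = sigma * eps * k ^+ 2].
  exists (Num.sqrt `|q|), (sigma * Num.sg q).
  rewrite mulrA -expr2 s2 mul1r sqr_sqrtr // -numEsg; split=> //.
    by rewrite gt_eqF // sqrtr_gt0 normr_gt0.
  case: sE => ->; case: sgrP q0 => // _ _;
  rewrite ?mulrN ?mulr1 ?opprK; by [left | right].
have [be eG] := eO.
(* The second column is the null eigenvector scaled by [k]. The third spans the other null line,
   with the factor [1 / (2 k)] making their product 1. *)
pose P := mx_of_rows 3 [:: [:: 1; 0; 0]; [:: 0; k * sigma; sigma / (2 * k)];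
                           [:: 0; k; - (2 * k)^-1]].
have PG : P^T *m gram h e *m P =
    mx_of_rows 3 [:: [:: 1; 0; 0]; [:: 0; 0; 1]; [:: 0; 1; 0]].
  rewrite eG /P tr_mx_of_rows3 !mul_mx_of_rows3; mx3_entries => //;
  case: sE => sE; rewrite ?sE; by field.
have PT : matrix_of e T *m P = P *m
    mx_of_rows 3 [:: [:: a; 0; 0]; [:: 0; D + sigma * q; eps];
                     [:: 0; 0; D + sigma * q]].
  rewrite eT AE qE /P !mul_mx_of_rows3; mx3_entries => //;
  case: sE => sE; rewrite ?sE; by field.
have [bY gY mY] := change_of_basis be PG invol_null PT.
by exists (comb e P), a, (D + sigma * q), eps; split.
Qed.
End Discriminant.

Lemma type_11_1_of_spacelike_block (e : 3.-tuple V) (a A D q : R) :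
  orthonormal_basis h e ->
  matrix_of e T = mx_of_rows 3 [:: [:: A; q; 0];
                                   [:: q; D; 0];
                                   [:: 0; 0; a]] ->
  type_11_1 h T.
Proof.
move=> [be eG] eM; have [p [r [pr dpr]]] := rotation (A - D) q.
exists (comb e (mx_of_rows 3 [:: [:: p; - r; 0]; [:: r; p; 0]; [:: 0; 0; 1]])).
(* The off-diagonal entry is left as the quadratic form that the choice of [p] and [r]
   annihilates. *)
pose M := mx_of_rows 3
  [:: [:: A * p ^+ 2 + 2 * q * p * r + D * r ^+ 2;
          q * (p ^+ 2 - r ^+ 2) - (A - D) * p * r; 0];
      [:: q * (p ^+ 2 - r ^+ 2) - (A - D) * p * r;
          A * r ^+ 2 - 2 * q * p * r + D * p ^+ 2; 0];
      [:: 0; 0; a]].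
have [|| eO ->] := @change_orthonormal e
    (mx_of_rows 3 [:: [:: p; - r; 0]; [:: r; p; 0]; [:: 0; 0; 1]]) M be.
- rewrite eG tr_mx_of_rows3 !mul_mx_of_rows3.
  by mx3_entries; first [ring | rewrite -[in RHS]pr; ring].
- rewrite eM !mul_mx_of_rows3 /M; mx3_entries;
    first [ring | rewrite -[LHS]mulr1 -[X in _ * X = _]pr; ring].
split=> //; rewrite /M dpr subrr.
by apply/is_diag_mxP; case=> [[|[|[|//]]] ?] [[|[|[|//]]] ?] //; rewrite mxE.
Qed.
End NormalForms.

(** * Brackets, connection and Ricci operator in coordinates *)

Section CurvatureComputation.
Variables (R : realType) (c : R) (g : lieAlgebra R) (x y z : g).
Hypotheses (hxyz : basis_of {:g} [tuple x; y; z])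
  (hxy : lie_br x y = 0) (hzx : lie_br z x = y)
  (hzy : lie_br z y = - c *: x + 2 *: y).

(** A normal form for vectors: sums, brackets and covariant derivatives rewrite into it, which turns
    vector identities into scalar ones for [field]. *)
Definition lc3 (p q r : R) : g := p *: x + q *: y + r *: z.

Lemma lc3E v : exists p q r, v = lc3 p q r.
Proof.
have := coord_basis hxyz (memvf v).
rewrite !big_ord_recl big_ord0 /= addr0 addrA => ->.
by do 3!eexists.
Qed.

Lemma lc3D p q r p' q' r' :
  lc3 p q r + lc3 p' q' r' = lc3 (p + p') (q + q') (r + r').
Proof. by rewrite /lc3 !scalerDl addrACA (addrACA (p *: x)). Qed.

Lemma lc3N p q r : - lc3 p q r = lc3 (- p) (- q) (- r).
Proof. by rewrite /lc3 !scaleNr !opprD. Qed.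

Lemma lc3Z a p q r : a *: lc3 p q r = lc3 (a * p) (a * q) (a * r).
Proof. by rewrite /lc3 !scalerDr !scalerA. Qed.

Lemma lc3_x : x = lc3 1 0 0.
Proof. by rewrite /lc3 scale1r !scale0r !addr0. Qed.
Lemma lc3_y : y = lc3 0 1 0.
Proof. by rewrite /lc3 scale1r !scale0r add0r addr0. Qed.
Lemma lc3_z : z = lc3 0 0 1.
Proof. by rewrite /lc3 scale1r !scale0r !add0r. Qed.

Lemma coord_lc3 p q r (i : 'I_3) :
  coord [tuple x; y; z] i (lc3 p q r) = [:: p; q; r]`_i.
Proof.
rewrite (_ : lc3 p q r = \sum_(i < 3) [:: p; q; r]`_i *: [tuple x; y; z]`_i).
  by rewrite coord_sum_free ?(basis_free hxyz).
by rewrite !big_ord_recl big_ord0 /= addr0 addrA.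
Qed.

Lemma lie_brC (u v : g) : lie_br u v = - lie_br v u.
Proof.
apply/eqP; rewrite -addr_eq0; have := lie_brxx (u + v).
by rewrite linearDl /= !linearDr /= !lie_brxx add0r addr0 => ->.
Qed.

(** The plane of [x] and [y] is an abelian ideal, so only the action of [z] on it contributes. *)
Lemma br_lc3 p q r p' q' r' :
  lie_br (lc3 p q r) (lc3 p' q' r')
  = lc3 (- c * (r * q' - q * r')) (r * p' - p * r' + 2 * (r * q' - q * r')) 0.
Proof.
have [lc30 zx zy] : [/\ 0 = lc3 0 0 0, lie_br z x = lc3 0 1 0
    & lie_br z y = lc3 (- c) 2 0].
  by rewrite hzx hzy -lc3_y /lc3 !scale0r !addr0.
rewrite {1 2}/lc3 !linearDl /= !linearDr /= !linearZl_LR /= !linearZr_LR /=.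
rewrite !lie_brxx (lie_brC y x) (lie_brC x z) (lie_brC y z) hxy zx zy.
rewrite lc30 !(lc3Z, lc3N, lc3D); congr lc3; ring.
Qed.

Section Metric.
Variable h : {symmetric g}.
Hypothesis nd : nondegenerate h.

Lemma form_lc3 (a11 a12 a13 a21 a22 a23 a31 a32 a33 p q r p' q' r' : R) :
  gram h [tuple x; y; z] = mx_of_rows 3 [:: [:: a11; a12; a13];
                                            [:: a21; a22; a23];
                                            [:: a31; a32; a33]] ->
  h (lc3 p q r) (lc3 p' q' r')
  = p * (p' * a11 + q' * a12 + r' * a13) + q * (p' * a21 + q' * a22 + r' * a23)
    + r * (p' * a31 + q' * a32 + r' * a33).
Proof.
move=> /matrixP hG.
have hE (i j : 'I_3) : h [tuple x; y; z]`_i [tuple x; y; z]`_j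
    = (nth [::] [:: [:: a11; a12; a13]; [:: a21; a22; a23];
                    [:: a31; a32; a33]] i)`_j.
  by have := hG i j; rewrite !mxE.
rewrite /lc3 !linearDl /= !linearDr /= !linearZl_LR /= !linearZr_LR /=.
rewrite (hE 0 0) (hE 0 1) (hE 0 2%:R) (hE 1 0) (hE 1 1) (hE 1 2%:R).
by rewrite (hE 2%:R 0) (hE 2%:R 1) (hE 2%:R 2%:R) /=; ring.
Qed.

(** A closed form for the connection can thus be verified against the Koszul formula, without ever
    computing [sharp]. *)
Lemma levi_civita_eq u v w :
  (forall w', 2 * h w w'
     = h (lie_br u v) w' + h (lie_br w' u) v + h (lie_br w' v) u) ->
  levi_civita h u v = w.
Proof.
move=> E; apply: (nondegenerate_inj nd) => w'.
apply: (mulfI (_ : 2 != 0 :> R)); first by rewrite pnatr_eq0.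
by rewrite koszul // E.
Qed.

Lemma ricci_op_eq u w : (forall v, h w v = ricci h u v) -> ricci_op h u = w.
Proof. by move=> E; apply: (nondegenerate_inj nd) => v; rewrite ricci_opP. Qed.

Lemma ricci_lc3 u v :
  ricci h u v = coord [tuple x; y; z] 0 (curvature h u (lc3 1 0 0) v)
    + coord [tuple x; y; z] 1 (curvature h u (lc3 0 1 0) v)
    + coord [tuple x; y; z] 2%:R (curvature h u (lc3 0 0 1) v).
Proof.
rewrite -lc3_x -lc3_y -lc3_z (ricciE nd _ _ hxyz) !big_ord_recl big_ord0.
(* The indices produced by [big_ord_recl] and the literal ones are ordinals with the same value. *)
by rewrite /= addr0 addrA; congr (_ + _ + _); congr (coord _ _ _); apply: val_inj.
Qed.

(** * Metrics degenerate on the plane of [x] and [y] *)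

Section NullPlane.
Variable mu : R.
Hypotheses (mu0 : mu != 0)
  (hG : gram h [tuple x; y; z] = mx_of_rows 3 [:: [:: mu; 0; 0];
                                                  [:: 0; 0; 1];
                                                  [:: 0; 1; 0]]).

Lemma levi_civita_null p q r p' q' r' :
  levi_civita h (lc3 p q r) (lc3 p' q' r')
  = lc3 ((- c * mu * (r * q' - q * r') - 2 * r * r') / (2 * mu))
        (- c * mu * (q * p' + q' * p) / 2 + p' * r + 2 * q' * r)
        (c * mu * (r * p' + r' * p) / 2 - 2 * r * r').
Proof.
apply: levi_civita_eq => w; have [a [b [d ->]]] := lc3E w.
by rewrite !br_lc3 !(form_lc3 _ _ _ _ _ _ hG); field.
Qed.

Lemma ricci_op_null p q r :
  ricci_op h (lc3 p q r)
  = lc3 (- (c ^+ 2 * mu / 2) * p) (c ^+ 2 * mu / 2 * q + c * r)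
        (c ^+ 2 * mu / 2 * r).
Proof.
apply: ricci_op_eq => w; have [a [b [d ->]]] := lc3E w.
rewrite ricci_lc3 !curvatureE // !(br_lc3, levi_civita_null, lc3N, lc3D).
by rewrite !coord_lc3 (form_lc3 _ _ _ _ _ _ hG) /=; field.
Qed.

Lemma matrix_of_ricci_null :
  matrix_of [tuple x; y; z] (ricci_op h)
  = mx_of_rows 3 [:: [:: - (c ^+ 2 * mu / 2); 0; 0];
                     [:: 0; c ^+ 2 * mu / 2; c];
                     [:: 0; 0; c ^+ 2 * mu / 2]].
Proof.
have := ricci_op_null 1 0 0; rewrite -lc3_x => Rx.
have := ricci_op_null 0 1 0; rewrite -lc3_y => Ry.
have := ricci_op_null 0 0 1; rewrite -lc3_z => Rz.
apply/matrixP; case=> [[|[|[|//]]] ?] [[|[|[|//]]] ?]; rewrite !mxE /=;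
by rewrite ?(Rx, Ry, Rz) coord_lc3 /=; ring.
Qed.
End NullPlane.

(** * Metrics nondegenerate on that plane, with [z] orthogonal to it and [m] of either sign *)

Section DefinitePlane.
Variables t m : R.
Hypotheses (t1 : t != 1) (m0 : m != 0)
  (hG : gram h [tuple x; y; z] = mx_of_rows 3 [:: [:: 1; 1; 0];
                                                  [:: 1; t; 0];
                                                  [:: 0; 0; m]]).

(* [sx] and [sy] are the pairings of [p *: x + q *: y] with [x] and [y] under
   the [h]-symmetric part of [ad z]. *)
Lemma levi_civita_definite p q r p' q' r' :
  levi_civita h (lc3 p q r) (lc3 p' q' r')
  = let sx := p + q * (t + 2 - c) / 2 in
    let sy := p * (t + 2 - c) / 2 + q * (2 * t - c) in
    let kx := - (r' * sx) - r * q' * (t + c - 2) / 2 in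
    let ky := - (r' * sy) + r * p' * (t + c - 2) / 2 in
    lc3 (kx - (ky - kx) / (t - 1)) ((ky - kx) / (t - 1))
        ((p' * sx + q' * sy) / m).
Proof.
apply: levi_civita_eq => w; have [a [b [d ->]]] := lc3E w.
rewrite !br_lc3 !(form_lc3 _ _ _ _ _ _ hG); field.
by rewrite m0 subr_eq0.
Qed.

(** Written through [p x + q y = (p + q) x - q (x - y)]: [x] maps to [A x + k / (1 - t) (x - y)] and
    [x - y] to [- k x + D (x - y)]. Here [A] and [D] are the diagonal entries for the normalised [x]
    and [x - y]. *)
Lemma ricci_op_definite p q r :
  ricci_op h (lc3 p q r)
  = let A := (t ^+ 2 + 2 * t - (c ^+ 2 - 2 * c + 4)) / (2 * (1 - t) * m) in
    let D := - ((t ^+ 2 - 6 * t - (c ^+ 2 - 2 * c - 4)) / (2 * (1 - t) * m)) in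
    let k := (c - t) / m in
    lc3 ((p + q) * (A + k / (1 - t)) - q * (D - k))
        (- (p + q) * k / (1 - t) + q * D)
        ((t ^+ 2 + (4 - 2 * c) * t + (c ^+ 2 - 4)) / (2 * (1 - t) * m) * r).
Proof.
apply: ricci_op_eq => w; have [a [b [d ->]]] := lc3E w.
rewrite ricci_lc3 !curvatureE // !(br_lc3, levi_civita_definite) /=.
rewrite !(br_lc3, levi_civita_definite, lc3N, lc3D) /=.
rewrite !coord_lc3 (form_lc3 _ _ _ _ _ _ hG) /=; field.
by rewrite m0 !subr_eq0 (eq_sym 1) t1.
Qed.

Lemma matrix_of_ricci_definite :
  matrix_of [tuple x; y; z] (ricci_op h)
  = let A := (t ^+ 2 + 2 * t - (c ^+ 2 - 2 * c + 4)) / (2 * (1 - t) * m) in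
    let D := - ((t ^+ 2 - 6 * t - (c ^+ 2 - 2 * c - 4)) / (2 * (1 - t) * m)) in
    let k := (c - t) / m in
    mx_of_rows 3
      [:: [:: A + k / (1 - t); A - D + k / (1 - t) + k; 0];
          [:: - (k / (1 - t)); D - k / (1 - t); 0];
          [:: 0; 0; (t ^+ 2 + (4 - 2 * c) * t + (c ^+ 2 - 4))
                    / (2 * (1 - t) * m)]].
Proof.
have := ricci_op_definite 1 0 0; rewrite -lc3_x => Rx.
have := ricci_op_definite 0 1 0; rewrite -lc3_y => Ry.
have := ricci_op_definite 0 0 1; rewrite -lc3_z => Rz.
apply/matrixP; case=> [[|[|[|//]]] ?] [[|[|[|//]]] ?]; rewrite !mxE /=;
by rewrite ?(Rx, Ry, Rz) coord_lc3 /=; ring.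
Qed.
End DefinitePlane.
End Metric.
End CurvatureComputation.

(** Trades a square root for a nonzero variable [s] with [a = s^2], so that the identities become
    rational and [field] applies. *)
Lemma pos_sqr (R : rcfType) (a : R) : 0 < a ->
  exists2 s, s != 0 & a = s ^+ 2 /\ Num.sqrt a = s.
Proof.
move=> a0; exists (Num.sqrt a); first by rewrite gt_eqF // sqrtr_gt0.
by rewrite sqr_sqrtr // ltW.
Qed.

(** * Ricci matrices and O'Neill types of the three families *)

Unset Implicit Arguments.

Theorem theorem3p11 (R : realType) (c : R) (hc : 1 < c)
  (g : lieAlgebra R) (x y z : g)
  (hxyz : basis_of {:g} [tuple x; y; z])
  (hxy : lie_br x y = 0) (hzx : lie_br z x = y)
  (hzy : lie_br z y = - c *: x + 2 *: y)
  (h : {symmetric g}) (hL : lorentzian h) :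
  [/\ (forall mu : R, 0 < mu ->
        gram h [tuple x; y; z] = mx_of_rows 3 [:: [:: mu; 0; 0];
                                                  [:: 0; 0; 1];
                                                  [:: 0; 1; 0]] ->
        let Y := [tuple (Num.sqrt mu)^-1 *: x;
                        (Num.sqrt 2)^-1 *: (y + z);
                        (Num.sqrt 2)^-1 *: (y - z)] in
        [/\ orthonormal_basis h Y,
            matrix_of Y (ricci_op h) =
              mx_of_rows 3
                [:: [:: - (c ^+ 2 * mu / 2); 0; 0];
                    [:: 0; c * (c * mu + 1) / 2; - (c / 2)];
                    [:: 0; c / 2; c * (c * mu - 1) / 2]]
          & type_21 h (ricci_op h)]),
      (forall mu tau : R, 0 < mu -> tau < 1 ->
        gram h [tuple x; y; z] = mx_of_rows 3 [:: [:: 1; 1; 0];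
                                                  [:: 1; tau; 0];
                                                  [:: 0; 0; mu]] ->
        let Y := [tuple (Num.sqrt mu)^-1 *: z;
                        x;
                        (Num.sqrt (1 - tau))^-1 *: (x - y)] in
        [/\ orthonormal_basis h Y,
            matrix_of Y (ricci_op h) =
              mx_of_rows 3
                [:: [:: (tau ^+ 2 + (4 - 2 * c) * tau + (c ^+ 2 - 4))
                          / (2 * (1 - tau) * mu); 0; 0];
                    [:: 0; (tau ^+ 2 + 2 * tau - (c ^+ 2 - 2 * c + 4))
                             / (2 * (1 - tau) * mu);
                           - ((c - tau) / (mu * Num.sqrt (1 - tau)))];
                    [:: 0; (c - tau) / (mu * Num.sqrt (1 - tau));
                           - ((tau ^+ 2 - 6 * tau - (c ^+ 2 - 2 * c - 4))
                               / (2 * (1 - tau) * mu))]],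
            0 < (c + tau) ^+ 2 - 4 * c -> type_11_1 h (ricci_op h),
            (c + tau) ^+ 2 - 4 * c < 0 -> type_1zz h (ricci_op h)
          & (c + tau) ^+ 2 - 4 * c = 0 -> type_21 h (ricci_op h)])
    & (forall mu nu : R, 0 < mu -> 1 < nu -> nu <= c ->
        gram h [tuple x; y; z] = mx_of_rows 3 [:: [:: 1; 1; 0];
                                                  [:: 1; nu; 0];
                                                  [:: 0; 0; - mu]] ->
        let Y := [tuple x;
                        (Num.sqrt (nu - 1))^-1 *: (x - y);
                        (Num.sqrt mu)^-1 *: z] in
        [/\ orthonormal_basis h Y,
            matrix_of Y (ricci_op h) =
              mx_of_rows 3
                [:: [:: (nu ^+ 2 + 2 * nu - (c ^+ 2 - 2 * c + 4))
                          / (2 * (nu - 1) * mu);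
                        (c - nu) / (mu * Num.sqrt (nu - 1)); 0];
                    [:: (c - nu) / (mu * Num.sqrt (nu - 1));
                        - ((nu ^+ 2 - 6 * nu - (c ^+ 2 - 2 * c - 4))
                            / (2 * (nu - 1) * mu)); 0];
                    [:: 0; 0; ((nu - c) ^+ 2 + 4 * (nu - 1))
                                / (2 * (nu - 1) * mu)]]
          & type_11_1 h (ricci_op h)])].
Proof.
have nd : nondegenerate h by case: hL.
split.
- move=> mu mu0 hG Y.
  have Ric := matrix_of_ricci_null hxyz hxy hzx hzy nd (lt0r_neq0 mu0) hG.
  have [m m0 [muE sqE]] := pos_sqr mu0.
  have [k k2 kE] : exists2 k, k ^+ 2 = 1 / 2 & (Num.sqrt 2)^-1 = k :> R.
    by exists (Num.sqrt 2)^-1; rewrite // exprVn sqr_sqrtr ?div1r.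
  have YE : Y = comb [tuple x; y; z]
      (mx_of_rows 3 [:: [:: m^-1; 0; 0]; [:: 0; k; k]; [:: 0; k; - k]]).
    rewrite /Y sqE kE comb3E !scale0r !addr0 !add0r.
    by rewrite scaleNr -scalerBr -scalerDr.
  rewrite -/Y YE.
  have [|| YO YT] := change_orthonormal hxyz
    (P := mx_of_rows 3 [:: [:: m^-1; 0; 0]; [:: 0; k; k]; [:: 0; k; - k]])
    (M := mx_of_rows 3 [:: [:: - (c ^+ 2 * mu / 2); 0; 0];
                           [:: 0; c * (c * mu + 1) / 2; - (c / 2)];
                           [:: 0; c / 2; c * (c * mu - 1) / 2]])
    (T := ricci_op h) (h := h).
  + rewrite hG tr_mx_of_rows3 !mul_mx_of_rows3 muE.
    mx3_entries; try by field.
    * by transitivity (2 * k ^+ 2); [ring | rewrite k2; field].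
    * by transitivity (- (2 * k ^+ 2)); [ring | rewrite k2; field].
  + by rewrite Ric !mul_mx_of_rows3; mx3_entries; field.
  (* The diagonal entries differ by [c] and [q = c / 2], so the discriminant vanishes identically;
     [c > 1] gives [q <> 0]. *)
  split=> //; apply: (type_21_of_disc YO YT); last by field.
  by rewrite mulf_neq0 ?invr_neq0 ?pnatr_eq0 // gt_eqF // (lt_trans _ hc).
- move=> mu tau mu0 tau1 hG Y.
  have Ric := matrix_of_ricci_definite hxyz hxy hzx hzy nd
    (negbT (lt_eqF tau1)) (lt0r_neq0 mu0) hG.
  have [m m0 [muE sqmE]] := pos_sqr mu0.
  have tau1' : 0 < 1 - tau by rewrite subr_gt0.
  have [s s0 [sE sqsE]] := pos_sqr tau1'.
  have tauE : tau = 1 - s ^+ 2 by rewrite -sE; ring.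
  have YE : Y = comb [tuple x; y; z] (mx_of_rows 3 [:: [:: 0; 1; s^-1];
                                                       [:: 0; 0; - s^-1];
                                                       [:: m^-1; 0; 0]]).
    rewrite /Y sqmE sqsE comb3E !scale0r !addr0 !add0r.
    by rewrite scale1r scaleNr -scalerBr.
  rewrite -/Y YE.
  (* [A] is the eigenvalue on the first vector; [B], [q], [D] form the block tested by the
     discriminant. *)
  set A := _ / _; set B := _ / _; set q := _ / _; set D := - ((_ - (_ - _)) / _).
  have [|| YO YT] := change_orthonormal hxyz
    (P := mx_of_rows 3 [:: [:: 0; 1; s^-1]; [:: 0; 0; - s^-1];
                           [:: m^-1; 0; 0]])
    (M := mx_of_rows 3 [:: [:: A; 0; 0]; [:: 0; B; - q]; [:: 0; q; D]])
    (T := ricci_op h) (h := h).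
  + rewrite hG tr_mx_of_rows3 !mul_mx_of_rows3 muE tauE.
    by mx3_entries; field; rewrite ?m0 ?s0.
  + rewrite Ric !mul_mx_of_rows3 /A /B /q /D sqsE sE muE tauE.
    by mx3_entries; field; rewrite ?m0 ?s0.
  (* Here [B - D = - (c - tau) (c + tau - 2) / (s^2 mu)], and [(c + tau - 2)^2 - 4 (1 - tau) = (c +
     tau)^2 - 4 c]. *)
  have discE : (B - D) ^+ 2 - 4 * q ^+ 2
      = ((c - tau) / (s * mu)) ^+ 2 * ((c + tau) ^+ 2 - 4 * c) / s ^+ 2.
    by rewrite /B /q /D sqsE sE muE tauE; field; rewrite ?m0 ?s0.
  (* From [tau < 1 < c]: this makes the factor in front of [(c + tau)^2 - 4 c] positive and [q]
     nonzero. *)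
  have ct : c - tau != 0 by rewrite subr_eq0 gt_eqF // (lt_trans tau1).
  have w0 : 0 < ((c - tau) / (s * mu)) ^+ 2.
    rewrite lt_neqAle sqr_ge0 eq_sym expf_eq0 /=.
    by rewrite mulf_neq0 ?invr_neq0 ?mulf_neq0 // gt_eqF.
  have s20 : 0 < s ^+ 2 by rewrite -sE.
  split=> //.
  + move=> pos; apply: (type_11_1_of_disc YO YT).
    by rewrite discE divr_gt0 // mulr_gt0.
  + move=> neg; apply: (type_1zz_of_disc YO YT).
    by rewrite discE pmulr_llt0 ?invr_gt0 // pmulr_rlt0.
  + move=> zero; apply: (type_21_of_disc YO YT).
      by rewrite /q sqsE mulf_neq0 ?invr_neq0 ?mulf_neq0 // gt_eqF.
    by rewrite discE zero mulr0 mul0r.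
- move=> mu nu mu0 nu1 _ hG Y.
  have mu0' : - mu != 0 by rewrite oppr_eq0 gt_eqF.
  (* With [m = - mu], the denominator [(1 - nu) * m] becomes [(nu - 1) * mu]. *)
  have Ric := matrix_of_ricci_definite hxyz hxy hzx hzy nd
    (negbT (gt_eqF nu1)) mu0' hG.
  have [m m0 [muE sqmE]] := pos_sqr mu0.
  have nu1' : 0 < nu - 1 by rewrite subr_gt0.
  have [s s0 [sE sqsE]] := pos_sqr nu1'.
  have nuE : nu = 1 + s ^+ 2 by rewrite -sE; ring.
  have sE' : 1 - nu = - s ^+ 2 by rewrite -sE opprB.
  have YE : Y = comb [tuple x; y; z] (mx_of_rows 3 [:: [:: 1; s^-1; 0];
                                                       [:: 0; - s^-1; 0];
                                                       [:: 0; 0; m^-1]]).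
    rewrite /Y sqmE sqsE comb3E !scale0r !addr0 !add0r.
    by rewrite scale1r scaleNr -scalerBr.
  rewrite -/Y YE.
  (* The block [A], [q], [D] now sits on the two spacelike vectors, and [B] is the eigenvalue on the
     timelike one. *)
  set A := _ / _; set q := _ / _; set D := - ((_ - (_ - _)) / _); set B := _ / _.
  have [|| YO YT] := change_orthonormal hxyz
    (P := mx_of_rows 3 [:: [:: 1; s^-1; 0]; [:: 0; - s^-1; 0];
                           [:: 0; 0; m^-1]])
    (M := mx_of_rows 3 [:: [:: A; q; 0]; [:: q; D; 0]; [:: 0; 0; B]])
    (T := ricci_op h) (h := h).
  + rewrite hG tr_mx_of_rows3 !mul_mx_of_rows3 muE nuE.
    by mx3_entries; field; rewrite ?m0 ?s0.
  + rewrite Ric !mul_mx_of_rows3 /A /B /q /D sqsE sE' sE muE nuE.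
    by mx3_entries; field; rewrite ?m0 ?s0.
  by split=> //; apply: (type_11_1_of_spacelike_block YO YT).
Qed.
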